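(* Let $X$ be a normed space, let $F\subset X$ be a nonempty closed bounded convex set with $F\ne\{0\}$, and let $f:X\to(-\infty,\infty]$ be an extended-real-valued function. Let $T_F^f(x):=\inf\{\rho_F(y-x)+f(y)\mid y\in X\}$ for $x\in X$, where $\rho_F$ is the Minkowski gauge of $F$, and let $\bar x\in S_0:=\{x\in\mathrm{dom}\,T_F^f\mid T_F^f(x)=f(x)\}$. Suppose that $f$ satisfies a center-Lipschitz condition on $D:=\mathrm{dom}\,f$ at $\bar x$ with constant $\ell$, where $0\le\ell<\|F\|^{-1}$. Then $$\widehat\partial T_F^f(\bar x)=\widehat\partial f(\bar x)\cap\Big\{x^*\in X^*\;\Big|\;\sup_{u\in F}\langle-x^*,u\rangle\le1\Big\}.$$
   Context: $X$ is a (real) normed space, $X^*$ its topological dual, and $\langle\cdot,\cdot\rangle$ the pairing between them. The Minkowski gauge of $F$ is $\rho_F(x):=\inf\{t\ge0\mid x\in tF\}$ (with $\inf\emptyset=\infty$); $F$ is not assumed to contain $0$. $\|F\|:=\sup\{\|u\|\mid u\in F\}$. For $g:X\to[-\infty,\infty]$, $\mathrm{dom}\,g:=\{x\in X\mid |g(x)|<\infty\}$. For $\bar x\in\mathrm{dom}\,g$, the Fréchet subdifferential is $$\widehat\partial g(\bar x):=\Big\{x^*\in X^*\;\Big|\;\liminf_{x\to\bar x}\frac{g(x)-g(\bar x)-\langle x^*,x-\bar x\rangle}{\|x-\bar x\|}\ge0\Big\},$$ where the liminf is over $x\neq\bar x$. A function $g$ satisfies a center-Lipschitz condition on a set $D\subset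 X$ at $\bar x\in D$ with constant $\ell\ge0$ if $|g(x)-g(\bar x)|\le\ell\|x-\bar x\|$ for all $x\in D$. *)

(* Defs.v *)
From HB Require Import structures.
From mathcomp Require Import all_boot all_order all_algebra.
From mathcomp Require Import all_classical all_reals all_analysis.
Import Order.TTheory GRing.Theory Num.Theory numFieldNormedType.Exports.

Set Implicit Arguments.
Unset Strict Implicit.
Unset Printing Implicit Defensive.

Local Open Scope classical_set_scope.
Local Open Scope ring_scope.

Section Defs.
Context {R : realType} {X : normedModType R}.
Implicit Types (F D : set X) (f g : X -> \bar R).

Record dual := Dual {
  dual_fun :> {linear X -> R^o};
  dual_continuous : continuous dual_fun }.

(* ereal_inf set0 = +oo, as in the convention inf(emptyset) = oo. *)
Definition gauge F (x : X) : \bar R :=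
  ereal_inf [set t%:E | t in [set t : R | 0 <= t /\ [set t *: u | u in F] x]].

(* A real-valued supremum: only meaningful for F nonempty and bounded. *)
Definition set_norm F : R := sup [set `|u| | u in F].

Definition edom g : set X := [set x | g x \is a fin_num].

(* The sum never has the form oo - oo when f does not take the value -oo,
   since the gauge is nonnegative. *)
Definition min_time F f (x : X) : \bar R :=
  ereal_inf (range (fun y : X => (gauge F (y - x)%R + f y)%E)).

Definition S0 F f : set X :=
  [set x | edom (min_time F f) x /\ min_time F f x = f x].

(* Only meaningful for xbar in edom g.  The liminf is taken along the
   punctured neighborhoods of xbar. *)
Definition frechet_subdiff g (xbar : X) : set dual :=
  [set xs : dual | (0 <= limf_einf (fun x =>
     (g x - g xbar - (xs (x - xbar)%R)%:E) * (`|x - xbar|^-1)%:E) xbar^')%E].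

Definition center_lipschitz g D (xbar : X) (l : R) : Prop :=
  forall x, D x -> (`|g x - g xbar| <= (l * `|x - xbar|)%:E)%E.

End Defs.

Arguments dual {R} X.

(* Main.v *)
(* Both subdifferentials are read as first-order lower bounds near xbar, where
   T := min_time F f and f agree; T <= f gives one half of the inclusion from
   left to right, and T (xbar - t u) <= t + f xbar for u in F gives the other.
   Conversely, T x is an infimum over y of gauge F (y - x) + f y.  For y within
   K |x - xbar| of xbar, the sum of - xs (y - x) <= gauge F (y - x) and of the
   lower bound of f at y suffices.  For y farther away, the center-Lipschitz bound
   loses l |y - xbar| while the gauge gains at least |y - x| / |F|, and since
   l < 1 / |F| a large K compensates for the term xs (x - xbar). *)
Require Import Defs.
From HB Require Import structures.
From mathcomp Require Import all_boot all_order all_algebra.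
From mathcomp Require Import all_classical all_reals all_analysis.
From mathcomp Require Import lra.
Import Order.TTheory GRing.Theory Num.Theory numFieldNormedType.Exports.
Local Open Scope classical_set_scope.
Local Open Scope ring_scope.

Section Gauge.
Set Implicit Arguments.
Unset Strict Implicit.
Context (R : realType) (X : normedModType R).
Implicit Types (F : set X) (f : X -> \bar R).

Lemma gauge_scale_le F (t : R) (u : X) :
  0 <= t -> F u -> (gauge F (t *: u) <= t%:E)%E.
Proof.
by move=> t0 Fu; apply: ereal_inf_lbound; exists t => //; split=> //; exists u.
Qed.

(** Any representation [v = t *: u] with [u] in [F] gives [p v = t * p u <= t]. It serves for
    [p = - xs] and for a multiple of the norm. *)
Lemma le_gauge F (p : X -> R) (v : X) :
    (forall t u, 0 <= t -> p (t *: u) = t * p u) ->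
    (forall u, F u -> p u <= 1) ->
  ((p v)%:E <= gauge F v)%E.
Proof.
move=> pZ p1; apply: le_ereal_inf_tmp => _ [t [t0 [u Fu <-]] <-].
by rewrite lee_fin pZ // ler_piMr // p1.
Qed.

Lemma min_time_le F f (x y : X) :
  (min_time F f x <= gauge F (y - x)%R + f y)%E.
Proof. by apply: ereal_inf_lbound; exists y. Qed.

(** Take [y = x]: the gauge vanishes at [0 = 0 *: u], even if [F] does not contain [0]. *)
Lemma min_time_le_fun F f (x : X) : F !=set0 -> (min_time F f x <= f x)%E.
Proof.
move=> [u Fu]; apply: (le_trans (min_time_le F f x x)).
rewrite -[leRHS]add0e subrr; apply: leeD => //.
by rewrite -(scale0r u); exact: gauge_scale_le.
Qed.

Lemma norm_le_set_norm F (u : X) :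
  bounded_set F -> F u -> `|u| <= set_norm F.
Proof.
move=> [M [_ FM]] Fu; apply: ub_le_sup; last by exists u.
(* [bounded_set] yields norm bounds only strictly above [M]. *)
by exists (M + 1) => _ [v Fv <-]; apply: (FM (M + 1)) => //; lra.
Qed.

End Gauge.

Section Subdifferential.
Set Implicit Arguments.
Unset Strict Implicit.
Context (R : realType) (X : normedModType R).

Lemma le_difference_quotient (y : \bar R) (c s e n : R) : 0 < n ->
  ((- e)%:E <= (y - c%:E - s%:E) * (n^-1)%:E)%E
  = ((c + s - e * n)%:E <= y)%E.
Proof.
move=> n0; case: y => [y| |].
- rewrite -!EFinB -EFinM !lee_fin ler_pdivlMr //.
  by apply/idP/idP => ?; lra.
- by rewrite /= gt0_mulye ?lte_fin ?invr_gt0 // !leey.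
- by rewrite /= gt0_mulNye ?lte_fin ?invr_gt0 // !leeNy_eq.
Qed.

(** Clearing the denominator turns the liminf into an epsilon-delta bound. The centre, excluded from
    the liminf, may be included because the bound is an equality there. *)
Lemma frechet_subdiffP (g : X -> \bar R) (xbar : X) (c : R) (xs : dual X) :
    g xbar = c%:E ->
  frechet_subdiff g xbar xs <->
  forall e, 0 < e -> exists2 d, 0 < d & forall x, `|x - xbar| < d ->
    ((c + xs (x - xbar) - e * `|x - xbar|)%:E <= g x)%E.
Proof.
move=> gc; rewrite /frechet_subdiff /= limf_einfE gc; split=> [sub e e0|sub].
- have : ((- e)%:E < 0)%E by rewrite lte_fin oppr_lt0.
  move=> /lt_le_trans/(_ sub)/ereal_sup_gt[_ [V nV <-] Ve].
  have [d /= d0 dV] := (nbhs_normP _ _).1 nV.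
  exists d => // x xd; have [->|xx] := eqVneq x xbar.
    by rewrite gc subrr normr0 linear0 mulr0 addr0 subr0.
  rewrite -le_difference_quotient ?normr_gt0 ?subr_eq0 //.
  apply: (le_trans (ltW Ve)); apply: ereal_inf_lbound; exists x => //.
  by apply: dV => //=; rewrite distrC.
- apply/lee_addgt0Pr => e e0; have [d d0 dg] := sub e e0.
  rewrite -leeBlDr // sub0e -EFinN.
  apply: le_ereal_sup_tmp.
  exists (ereal_inf [set ((g x - c%:E - (xs (x - xbar)%R)%:E)
      * (`|x - xbar|^-1)%:E)%E | x in [set x | x != xbar /\ `|x - xbar| < d]]).
    exists [set x | x != xbar /\ `|x - xbar| < d] => //.
    apply/nbhs_normP; exists d => //= x xd xx; split=> //.
    by rewrite distrC.
  apply: le_ereal_inf_tmp => _ [x [xx xd] <-].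
  by rewrite le_difference_quotient ?normr_gt0 ?subr_eq0 //; exact: dg.
Qed.

Lemma dual_bounded (xs : dual X) :
  exists2 C : R, 0 < C & forall x, `|xs x| <= C * `|x|.
Proof.
apply: pinfty_ex_gt0; apply/linear_boundedP.
exact/linear_bounded_continuous/dual_continuous.
Qed.

(** Outside [edom f] the value is [+oo], so the lower bound extends to all of [X]. *)
Lemma center_lipschitz_ge (f : X -> \bar R) (xbar : X) (c l : R) (y : X) :
    (forall x, f x != -oo%E) -> f xbar = c%:E ->
    center_lipschitz f (edom f) xbar l ->
  ((c - l * `|y - xbar|)%:E <= f y)%E.
Proof.
move=> fNy fc lip; have := lip y; have := fNy y; rewrite /edom /= fc.
case: (f y) => [r| |] // _; last by rewrite leey.
move=> /(_ isT); rewrite -EFinB /= !lee_fin => /ler_normlP[]; lra.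
Qed.

End Subdifferential.

Theorem corollary2p4 (R : realType) (X : normedModType R) (F : set X)
    (f : X -> \bar R) (xbar : X) (l : R)
    (F_nonempty : F !=set0) (F_closed : closed F) (F_bounded : bounded_set F)
    (F_convex : convex_set F) (F_neq0 : F <> [set 0])
    (f_gtNy : forall x, f x != -oo%E)
    (xbar_S0 : S0 F f xbar)
    (l_ge0 : 0 <= l) (l_lt : l < (set_norm F)^-1)
    (f_lip : center_lipschitz f (edom f) xbar l) :
  frechet_subdiff (min_time F f) xbar =
  frechet_subdiff f xbar `&`
    [set xs : dual X | (ereal_sup [set (- xs u)%:E | u in F] <= 1)%E].
Proof.
have [/EFin_fin_numP[c Tc] Tf] := xbar_S0.
have fc : f xbar = c%:E by rewrite -Tf.
set m := (set_norm F)^-1 in l_lt.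
apply/seteqP; split=> xs.
- move=> /(frechet_subdiffP _ Tc) sub; split.
    apply/(frechet_subdiffP _ fc) => e e0.
    have [d d0 dT] := sub e e0; exists d => // x xd.
    exact: le_trans (dT x xd) (min_time_le_fun _ _ F_nonempty).
  apply: ge_ereal_sup => _ [u Fu <-]; rewrite lee_fin.
  have [->|u0] := eqVneq u 0; first by rewrite linear0 oppr0.
  have nu0 : 0 < `|u| by rewrite normr_gt0.
  apply/ler_addgt0Pr => e e0.
  (* Over a step of length [t * |u|], this tolerance costs exactly [e * t]; dividing by [t] leaves
     [- xs u <= 1 + e]. *)
  have [d d0 dT] := sub (e / `|u|) (divr_gt0 e0 nu0).
  pose t := d / 2 / `|u|.
  have t0 : 0 < t by rewrite !divr_gt0.
  have xbartu : xbar - t *: u - xbar = - (t *: u) by rewrite addrC addKr.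
  have ntu : `|- (t *: u)| = t * `|u| by rewrite normrN normrZ gtr0_norm.
  have tud : t * `|u| < d by rewrite /t divfK ?gt_eqF //; lra.
  have := dT (xbar - t *: u); rewrite xbartu ntu => /(_ tud) le1.
  have := le_trans le1 (min_time_le F f _ xbar).
  rewrite opprB addrCA subrr addr0 fc => le2.
  have : ((c + xs (- (t *: u)) - e / `|u| * (t * `|u|))%:E <= (t + c)%:E)%E.
    apply: (le_trans le2); rewrite EFinD; apply: leeD => //.
    by apply: gauge_scale_le => //; exact: ltW.
  rewrite lee_fin linearN linearZ /= mulrCA divfK ?gt_eqF // => le3.
  rewrite -(ler_pM2l t0) mulrDr mulr1 mulrN.
  move: le3; rewrite /GRing.scale /=; lra.
- move=> [/(frechet_subdiffP _ fc) sub supF].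
  apply/(frechet_subdiffP _ Tc) => e e0.
  have xsF v : ((- xs v)%:E <= gauge F v)%E.
    apply: (@le_gauge _ _ F (fun v => - xs v)) => [t u _|u Fu].
      by rewrite linearZ mulrN.
    by rewrite -lee_fin; apply: le_trans supF; apply: ereal_sup_ubound; exists u.
  have m0 : 0 < m by exact: le_lt_trans l_lt.
  have normF v : ((m * `|v|)%:E <= gauge F v)%E.
    apply: (@le_gauge _ _ F (fun v => m * `|v|)) => [t u t0|u Fu].
      by rewrite normrZ ger0_norm // mulrCA.
    (* Inversion preserves signs, with [0^-1 = 0], so [0 < m] forces this. *)
    have M0 : 0 < set_norm F by rewrite -invr_gt0.
    by rewrite /m mulrC ler_pdivrMr // mul1r norm_le_set_norm.
  have [C C0 xsC] := dual_bounded xs.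
  (* With this K the slack (m - l) |y - xbar| beats m |x - xbar| + <xs, x - xbar>
     as soon as |y - xbar| >= K |x - xbar|. *)
  pose K := (C + m) / (m - l).
  have ml0 : 0 < m - l by rewrite subr_gt0.
  have K0 : 0 < K by rewrite divr_gt0 // addr_gt0.
  (* The factor [K] between the two distances is absorbed in both the tolerance and the radius. *)
  have [d d0 df] := sub (e / K) (divr_gt0 e0 K0).
  exists (d / K); first exact: divr_gt0.
  move=> x xd; apply: le_ereal_inf_tmp => _ [y _ <-].
  have [yK|yK] := leP `|y - xbar| (K * `|x - xbar|).
  + have yd : `|y - xbar| < d.
      by apply: le_lt_trans yK _; rewrite mulrC -ltr_pdivlMr.
    apply: le_trans (leeD (xsF (y - x)) (df y yd)).
    rewrite -EFinD lee_fin.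
    have xsB : xs (x - xbar) = xs (y - xbar) - xs (y - x).
      by rewrite -linearB /= opprB [X in _ = xs X]addrC addrA subrK.
    have : e / K * `|y - xbar| <= e * `|x - xbar|.
      by rewrite -mulrA ler_pM2l // mulrC ler_pdivrMr // mulrC.
    rewrite xsB; lra.
  + apply: le_trans (leeD (normF (y - x))
      (center_lipschitz_ge y f_gtNy fc f_lip)).
    rewrite -EFinD lee_fin.
    (* With [Ky], this gives [m * |y - x| - l * |y - xbar| >= C * |x - xbar|], which dominates
       [xs (x - xbar)]. *)
    have xy : m * (`|y - xbar| - `|x - xbar|) <= m * `|y - x|.
      rewrite ler_pM2l //; apply: le_trans (lerB_dist _ _) _.
      by rewrite opprB addrA subrK.
    have Ky : (C + m) * `|x - xbar| <= (m - l) * `|y - xbar|.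
      have := ltW yK; rewrite -(ler_pM2l ml0) mulrA.
      by rewrite /K [_ * (_ / _)]mulrC divfK ?gt_eqF.
    have := le_trans (ler_norm _) (xsC (x - xbar)).
    have : 0 <= e * `|x - xbar| by rewrite mulr_ge0 // ltW.
    lra.
Qed.
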